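(* Fix $\alpha>2$. (i) There exist a constant $c>0$ and a family of instances (finite point sets $\mathcal{X}\subset\mathbb{R}^d$ together with a clustering of $\mathcal{X}$ of cost $\texttt{OPT}$), along which $g_\alpha$ is unbounded, such that on each instance $D^\alpha$ seeding returns a set of centers $Z_k$ with $\mathbb{E}[\mathrm{cost}^{(2)}(\mathcal{X},Z_k)]\ge c\,(g_\alpha)^{2/\alpha}\cdot\texttt{OPT}$. (ii) There exist a constant $c>0$ and a family of instances (finite point sets with a clustering of cost $\texttt{OPT}$), along which $\sigma_{\mathrm{max}}/\sigma_{\mathrm{min}}$ is unbounded, such that on each instance $D^\alpha$ seeding returns $Z_k$ with $\mathbb{E}[\mathrm{cost}^{(2)}(\mathcal{X},Z_k)]\ge c\left(\frac{\sigma_{\mathrm{max}}}{\sigma_{\mathrm{min}}}\right)^{2-4/\alpha}\cdot\texttt{OPT}$.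
   Context: For a finite set $C\subset\mathbb{R}^d$ and a finite nonempty set $T$, $\mathrm{cost}^{(\beta)}(C,T)=\sum_{x\in C}\min_{c\in T}\lVert x-c\rVert^\beta$, and $\mathrm{cost}^{(\beta)}(C,y)=\mathrm{cost}^{(\beta)}(C,\{y\})$. $D^\alpha$ seeding on $\mathcal{X}$ with $k$ centers: $z_1$ uniform in $\mathcal{X}$; given current centers $Z_t$ ($t<k$), $z_{t+1}\in\mathcal{X}$ is chosen with probability proportional to $\min_{c\in Z_t}\lVert z-c\rVert^\alpha$. For a clustering $(C_1,\dots,C_k)$ of $\mathcal{X}$: $\mu_C$ is the mean of $C$, $\sigma_C=\sqrt{\frac1{|C|}\sum_{x\in C}\lVert x-\mu_C\rVert^2}$, $\sigma_{\mathrm{max}},\sigma_{\mathrm{min}}$ are the max and min of $\sigma_{C_j}$, $\texttt{OPT}=\sum_j|C_j|\sigma_{C_j}^2$, and $g_\alpha=\max_j\frac{(1/|C_j|^2)\sum_{z\in C_j}\mathrm{cost}^{(\alpha)}(C_j,z)}{(\mathrm{cost}^{(2)}(C_j,\mu_{C_j})/|C_j|)^{\alpha/2}}$. *)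

(* Defs.v *)
From HB Require Import structures.
From mathcomp Require Import all_boot all_order all_algebra.
From mathcomp Require Import finmap.
From mathcomp Require Import all_classical all_reals all_analysis.

Set Implicit Arguments.
Unset Strict Implicit.
Unset Printing Implicit Defensive.

Import Order.TTheory GRing.Theory Num.Theory.
Local Open Scope fset_scope.
Local Open Scope ring_scope.

(* The norm supplied by the library on ['rV[R]_d] is the sup norm. *)
Definition enorm (R : realType) (d : nat) (x : 'rV[R]_d) : R :=
  Num.sqrt (\sum_(i < d) x 0 i ^+ 2).

(* Minimum and maximum of a finite family; the value on [::] is 0, by
   convention, and is never used below. *)
Definition seqmin (R : realType) (s : seq R) : R :=
  \big[Num.min/head 0 s]_(a <- s) a.

Definition seqmax (R : realType) (s : seq R) : R :=
  \big[Num.max/head 0 s]_(a <- s) a.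

Definition mindist (R : realType) (d : nat) (beta : R)
    (x : 'rV[R]_d) (T : {fset 'rV[R]_d}) : R :=
  seqmin [seq enorm (x - c) `^ beta | c <- T].

Definition cost (R : realType) (d : nat) (beta : R)
    (C T : {fset 'rV[R]_d}) : R :=
  \sum_(x <- C) mindist beta x T.

Definition mean (R : realType) (d : nat) (C : {fset 'rV[R]_d}) : 'rV[R]_d :=
  (#|` C|%:R : R)^-1 *: \sum_(x <- C) x.

Definition sigma (R : realType) (d : nat) (C : {fset 'rV[R]_d}) : R :=
  Num.sqrt ((#|` C|%:R)^-1 * \sum_(x <- C) enorm (x - mean C) ^+ 2).

Section Seeding.
Variables (R : realType) (d : nat) (alpha : R) (X : {fset 'rV[R]_d}).

(* Probability that [x] is the next center when the current centers are [Z];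
   for nonempty [Z] the denominator vanishes only if [X] is contained in [Z]. *)
Definition next_prob (Z : {fset 'rV[R]_d}) (x : 'rV[R]_d) : R :=
  mindist alpha x Z / \sum_(y <- X) mindist alpha y Z.

Definition first_centers (k : nat) (z : {ffun 'I_k -> X}) (t : nat) :
    {fset 'rV[R]_d} :=
  [fset val (z i) | i in [pred i : 'I_k | (i < t)%N]].

(* Joint law of the successive centers; 0-based, so the uniformly chosen
   center has index 0 and the center of index t is drawn given t centers. *)
Definition seeding_prob (k : nat) (z : {ffun 'I_k -> X}) : R :=
  \prod_(t < k)
    if t == 0%N :> nat then (#|` X|%:R)^-1
    else next_prob (first_centers z t) (val (z t)).

Definition expected_cost (beta : R) (k : nat) : R :=
  \sum_(z : {ffun 'I_k -> X})
    seeding_prob z * cost beta X (first_centers z k).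

End Seeding.

Record instance (R : realType) := Instance {
  dim : nat;
  points : {fset 'rV[R]_dim};
  ncl : nat;
  cluster : 'I_ncl -> {fset 'rV[R]_dim};
  ncl_gt0 : (0 < ncl)%N;
  cluster_neq0 : forall j, cluster j != fset0;
  cluster_disjoint : forall i j, i != j -> [disjoint cluster i & cluster j]%fset;
  cluster_cover : forall x, x \in points <-> exists j, x \in cluster j }.

Section InstanceParameters.
Variables (R : realType) (I : instance R).

Definition sigma_max : R := seqmax [seq sigma (cluster j) | j : 'I_(ncl I)].

Definition sigma_min : R := seqmin [seq sigma (cluster j) | j : 'I_(ncl I)].

Definition OPT : R :=
  \sum_(j < ncl I) #|` cluster j|%:R * sigma (cluster j) ^+ 2.

Definition g (alpha : R) : R :=
  seqmax
    [seq ((#|` cluster j|%:R ^+ 2)^-1 *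
            \sum_(z <- cluster j) cost alpha (cluster j) [fset z]) /
         (cost 2 (cluster j) [fset mean (cluster j)] / #|` cluster j|%:R)
           `^ (alpha / 2)
    | j : 'I_(ncl I)].

(* Seeding opens as many centers as there are clusters. *)
Definition seeding_cost (alpha : R) : R :=
  expected_cost alpha (points I) 2 (ncl I).

(* Without this, [g] and [sigma_max / sigma_min] involve a division by 0. *)
Definition clusters_spread : Prop := forall j : 'I_(ncl I), 0 < sigma (cluster j).

End InstanceParameters.

(* Main.v *)
(* One family of instances on the line, with k = 2, serves both parts. Let m be
   even. The sparse cluster has m points in [0, 1/m] and an outlier at -1; the
   dense cluster has m points within [1/m] of each other at distance about
   [L = m^(-1/alpha)] from the bulk of the sparse one. The outlier dominates
   OPT, which is of order 1. With constant probability the first center lies in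
   the bulk of the sparse cluster; the outlier and the whole dense cluster then
   have [D^alpha]-weights of order 1 each, because [m L^alpha = 1], so with
   constant probability the second center is the outlier. The dense cluster is
   left uncovered and costs at least [m L^2 = m^(1 - 2/alpha)]. On the other
   hand the sparse cluster has [sigma^2] of order 1/m, so [g_alpha] is of order
   [m^(alpha/2 - 1)], and the dense one has [sigma] of order 1/m, so
   [sigma_max / sigma_min] is of order [sqrt m]: both lower bounds ask for
   exactly [m^(1 - 2/alpha)]. *)
Require Import Defs.
From mathcomp Require Import all_boot all_order all_algebra.
From mathcomp Require Import finmap.
From mathcomp Require Import all_classical all_reals all_analysis.
From mathcomp Require Import ring lra.
Set Implicit Arguments.
Unset Strict Implicit.
Unset Printing Implicit Defensive.

Import Order.TTheory GRing.Theory Num.Theory.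
Local Open Scope fset_scope.
Local Open Scope ring_scope.

(** * Minimum and maximum of a finite family *)

Section FiniteExtrema.
Variable R : realType.
Implicit Types (s : seq R) (v : R).

Lemma le_seqmin s v :
  s != [::] -> (forall a, a \in s -> v <= a) -> v <= seqmin s.
Proof.
case: s => // a s _ vs; rewrite /seqmin big_seq; apply: le_bigmin => //=.
by apply: vs; rewrite mem_head.
Qed.

Lemma seqmin_le s v : v \in s -> seqmin s <= v.
Proof. by move=> vs; apply: (ge_bigmin_seq _ v xpredT id vs). Qed.

Lemma seqmax_le s v :
  s != [::] -> (forall a, a \in s -> a <= v) -> seqmax s <= v.
Proof.
case: s => // a s _ vs; rewrite /seqmax big_seq; apply: bigmax_le => //=.
by apply: vs; rewrite mem_head.
Qed.

Lemma le_seqmax s v : v \in s -> v <= seqmax s.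
Proof. by move=> vs; apply: (le_bigmax_seq _ v xpredT id vs). Qed.

End FiniteExtrema.

(** * Seeding with two centers *)

Section Seeding.
Variables (R : realType) (d : nat).
Implicit Types (beta v : R) (x p : 'rV[R]_d) (X S T : {fset 'rV[R]_d}).

Lemma mindist1 beta x p : mindist beta x [fset p] = enorm (x - p) `^ beta.
Proof. by rewrite /mindist /seqmin -fset_seq1 big_cons big_nil minxx. Qed.

Lemma cost1 beta X p :
  cost beta X [fset p] = \sum_(x <- X) enorm (x - p) `^ beta.
Proof. by apply: eq_bigr => x _; rewrite mindist1. Qed.

Lemma mindist_ge0 beta x T : 0 <= mindist beta x T.
Proof.
rewrite /mindist; have [->|nil] := eqVneq [seq enorm (x - c) `^ beta | c <- T] [::].
  by rewrite /seqmin big_nil.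
by apply: le_seqmin => // _ /mapP[c _ ->]; apply: powR_ge0.
Qed.

Lemma le_mindist2 beta x p q v :
  v <= enorm (x - p) `^ beta -> v <= enorm (x - q) `^ beta ->
  v <= mindist beta x [fset p; q].
Proof.
move=> vp vq; apply: le_seqmin => [|_ /mapP[c cpq ->]]; last first.
  by move: cpq; rewrite !inE => /orP[]/eqP->.
rewrite -size_eq0 size_map -lt0n cardfs_gt0.
by apply/fset0Pn; exists p; rewrite !inE eqxx.
Qed.

Lemma cost_ge0 beta X T : 0 <= cost beta X T.
Proof. by apply: sumr_ge0 => x _; apply: mindist_ge0. Qed.

Lemma next_prob_ge0 beta X T x : 0 <= next_prob beta X T x.
Proof.
by rewrite divr_ge0 ?mindist_ge0 //; apply: sumr_ge0 => y _; apply: mindist_ge0.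
Qed.

Lemma first_centers1 X (z : {ffun 'I_2 -> X}) :
  first_centers z 1 = [fset val (z ord0)].
Proof.
apply/fsetP => x; rewrite in_fset1; apply/imfsetP/eqP => [[i /=]|->].
  move=> iP ->; have /eqP i0 : val i == 0%N by rewrite -leqn0 -ltnS.
  by congr (val (z _)); apply/val_inj.
by exists ord0.
Qed.

Lemma first_centers2 X (z : {ffun 'I_2 -> X}) :
  first_centers z 2 = [fset val (z ord0); val (z ord_max)].
Proof.
apply/fsetP => x; rewrite in_fset2; apply/imfsetP/orP => [[i _ ->]|].
  case: i => -[|[|//]] i2; [left|right]; apply/eqP; congr (val (z _));
    exact/val_inj.
by case=> /eqP->; [exists ord0|exists ord_max].
Qed.

Lemma seeding_prob2 alpha X (z : {ffun 'I_2 -> X}) :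
  seeding_prob alpha z = (#|` X|%:R)^-1 *
    next_prob alpha X [fset val (z ord0)] (val (z ord_max)).
Proof.
rewrite /seeding_prob 2!big_ord_recl big_ord0 mulr1 /=; congr (_ * _).
have -> : lift ord0 ord0 = ord_max :> 'I_2 by apply/val_inj.
by rewrite first_centers1.
Qed.

(** All terms of the expectation are nonnegative, so it suffices to keep the draws whose first
    center lies in [S] and whose second center is [p]. *)
Lemma expected_cost2_ge alpha X S p v :
  S `<=` X -> p \in X ->
  (forall a, a \in S ->
     v <= next_prob alpha X [fset a] p * cost 2 X [fset a; p]) ->
  #|` S|%:R * ((#|` X|%:R)^-1 * v) <= expected_cost alpha X 2 2.
Proof.
move=> SX pX Sv; pose f (z : {ffun 'I_2 -> X}) :=
  seeding_prob alpha z * cost 2 X (first_centers z 2).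
have fge0 z : 0 <= f z.
  by rewrite mulr_ge0 ?cost_ge0 // seeding_prob2 mulr_ge0 ?invr_ge0 ?next_prob_ge0.
(* [h x] is the draw [(x, p)]. Injectivity makes different first centers contribute different terms
   of the sum. *)
pose h (x : X) : {ffun 'I_2 -> X} :=
  [ffun i => if i == ord0 then x else [` pX]%fset].
have h_inj : injective h by move=> x y /ffunP/(_ ord0); rewrite !ffunE.
pose w := (#|` X|%:R)^-1 * v.
apply: (@le_trans _ _ (\sum_(x : X | val x \in S) w)).
  rewrite -(big_seq_fsetE _ X (fun x => x \in S) (fun=> w)) /= big_mkcond /=.
  rewrite -(big_fset_incl _ SX) => [|x _ /negPf->] //.
  rewrite big_seq (eq_bigr (fun=> w)) => [|x -> //].
  by rewrite -big_seq big_const_seq count_predT iter_addr_0 mulr_natl.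
apply: (@le_trans _ _ (\sum_(z in [set h x | x in [pred x : X | val x \in S]]) f z)).
  rewrite big_imset /=; last by move=> x y _ _; apply: h_inj.
  apply: ler_sum => x xS; rewrite /f seeding_prob2 first_centers2 !ffunE /=.
  by rewrite -mulrA ler_wpM2l ?invr_ge0 //; apply: Sv.
rewrite [leRHS](bigID (mem [set h x | x in [pred x : X | val x \in S]])) /=.
by rewrite lerDl; apply: sumr_ge0 => z _; apply: fge0.
Qed.

End Seeding.

(** * Finite point sets on the line, handled as lists of reals *)

Section RealLine.
Variable R : realType.
Implicit Types (s : seq R) (beta x y : R).

Definition line s : {fset 'rV[R]_1} := [fset const_mx x | x in s].

Lemma const_mx1_inj : injective (@const_mx R 1 1).
Proof. by move=> x y /matrixP/(_ 0 0); rewrite !mxE. Qed.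

Lemma mem_line s x : (const_mx x \in line s) = (x \in s).
Proof. by rewrite /line mem_imfset //; apply: const_mx1_inj. Qed.

Lemma perm_line s : uniq s -> perm_eq (line s) [seq const_mx x | x <- s].
Proof.
move=> us; apply: uniq_perm; first exact: fset_uniq.
  by rewrite map_inj_uniq //; apply: const_mx1_inj.
by move=> z; apply/imfsetP/mapP => -[x xs ->]; exists x.
Qed.

Lemma card_line s : uniq s -> #|` line s| = size s.
Proof. by move=> us; rewrite (perm_size (perm_line us)) size_map. Qed.

Lemma sum_line (V : nmodType) s (F : 'rV[R]_1 -> V) :
  uniq s -> \sum_(x <- line s) F x = \sum_(x <- s) F (const_mx x).
Proof. by move=> us; rewrite (perm_big _ (perm_line us)) big_map. Qed.

Lemma enorm_const x y : enorm (const_mx x - const_mx y : 'rV[R]_1) = `|x - y|.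
Proof. by rewrite /enorm big_ord1 !mxE sqrtr_sqr. Qed.

Lemma sum_le_const (s : seq R) (F : R -> R) v :
  (forall x, x \in s -> F x <= v) -> \sum_(x <- s) F x <= (size s)%:R * v.
Proof.
move=> Fv; rewrite mulr_natl big_seq.
apply: (@le_trans _ _ (\sum_(x <- s | x \in s) v)); first exact: ler_sum.
by rewrite -big_seq big_const_seq count_predT iter_addr_0.
Qed.

Lemma const_le_sum (s : seq R) (F : R -> R) v :
  (forall x, x \in s -> v <= F x) -> (size s)%:R * v <= \sum_(x <- s) F x.
Proof.
move=> Fv; rewrite mulr_natl [leRHS]big_seq.
apply: (@le_trans _ _ (\sum_(x <- s | x \in s) v)); last exact: ler_sum.
by rewrite -big_seq big_const_seq count_predT iter_addr_0.
Qed.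

Definition average s : R := (size s)%:R^-1 * \sum_(x <- s) x.

Definition sqdev s : R := \sum_(x <- s) (x - average s) ^+ 2.

Lemma mean_line s : uniq s -> mean (line s) = const_mx (average s).
Proof.
move=> us; rewrite /mean card_line // sum_line //; apply/matrixP => i j.
rewrite !mxE summxE /average; congr (_ * _).
by apply: eq_bigr => x _; rewrite mxE.
Qed.

Lemma sqdev_ge0 s : 0 <= sqdev s.
Proof. by apply: sumr_ge0 => x _; rewrite sqr_ge0. Qed.

Lemma sigma_line_sqr s : uniq s -> sigma (line s) ^+ 2 = sqdev s / (size s)%:R.
Proof.
move=> us; rewrite /sigma card_line // sum_line // mean_line // mulrC.
have -> : \sum_(x <- s) enorm (const_mx x - const_mx (average s) : 'rV[R]_1) ^+ 2 =
    sqdev s by apply: eq_bigr => x _; rewrite enorm_const real_normK ?num_real.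
by rewrite sqr_sqrtr // divr_ge0 ?sqdev_ge0.
Qed.

Lemma cost_mean_line s :
  uniq s -> cost 2 (line s) [fset mean (line s)] = sqdev s.
Proof.
move=> us; rewrite cost1 sum_line // mean_line //.
by apply: eq_bigr => x _; rewrite enorm_const powR_mulrn // real_normK ?num_real.
Qed.

(** Expansion around the average: the cross term vanishes and the rest is a sum of squares. Upper
    bounds can thus use any convenient [y] and never compute the average. *)
Lemma sqdev_le s y : sqdev s <= \sum_(x <- s) (x - y) ^+ 2.
Proof.
have [->|s0] := eqVneq s [::]; first by rewrite /sqdev !big_nil.
have n0 : (size s)%:R != 0 :> R by rewrite pnatr_eq0 size_eq0.
set mu := average s.
have dev0 : \sum_(x <- s) (x - mu) = 0.
  rewrite sumrB big_const_seq count_predT iter_addr_0 -mulr_natl /mu /average.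
  by rewrite mulVKf ?subrr.
have -> : \sum_(x <- s) (x - y) ^+ 2 =
    sqdev s + \sum_(x <- s) (x - mu) * (2 * (mu - y)) + \sum_(x <- s) (mu - y) ^+ 2.
  by rewrite /sqdev -!big_split /=; apply: eq_bigr => x _; rewrite -/mu; ring.
by rewrite -mulr_suml dev0 mul0r addr0 lerDl sumr_ge0 // => x _; rewrite sqr_ge0.
Qed.

(** The difference of the two sides is half the square of [x + y - 2 * u]. Two distant points thus
    force a large deviation around any center [u], in particular around an average of unknown
    value. *)
Lemma sqr_split_ge x y u : (x - y) ^+ 2 / 2 <= (x - u) ^+ 2 + (y - u) ^+ 2.
Proof. by have := sqr_ge0 (x + y - 2 * u); lra. Qed.

(** The term of [g] that comes from the cluster listed by [s], in terms of real numbers. *)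
Definition spread_ratio beta s : R :=
  ((size s)%:R ^+ 2)^-1 * (\sum_(z <- s) \sum_(x <- s) `|x - z| `^ beta) /
    (sqdev s / (size s)%:R) `^ (beta / 2).

Lemma spread_ratio_line beta s : uniq s ->
  ((#|` line s|%:R ^+ 2)^-1 *
            \sum_(z <- line s) cost beta (line s) [fset z]) /
         (cost 2 (line s) [fset mean (line s)] / #|` line s|%:R)
           `^ (beta / 2) = spread_ratio beta s.
Proof.
move=> us; rewrite cost_mean_line // card_line // sum_line //.
congr (_ * _ / _); apply: eq_bigr => z _; rewrite cost1 sum_line //.
by apply: eq_bigr => x _; rewrite enorm_const.
Qed.

End RealLine.

(** * Instances on the line with two clusters *)

Section TwoClusters.
Variables (R : realType) (sA sB : seq R).
Hypotheses (uAB : uniq (sA ++ sB)) (sA0 : sA != [::]) (sB0 : sB != [::]).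

Definition two_clusters (j : 'I_2) : {fset 'rV[R]_1} :=
  line (if j == ord0 then sA else sB).

Lemma two_clusters_neq0 j : two_clusters j != fset0.
Proof.
have line_neq0 (s : seq R) : s != [::] -> line s != fset0.
  case: s => // x s _; apply/fset0Pn; exists (const_mx x).
  by rewrite mem_line mem_head.
by rewrite /two_clusters; case: ifP => _; apply: line_neq0.
Qed.

Lemma two_clusters_disjoint i j :
  i != j -> [disjoint two_clusters i & two_clusters j].
Proof.
have dAB : [disjoint line sA & line sB].
  apply/fdisjointP => _ /imfsetP[x /= xA ->]; rewrite mem_line.
  move: uAB; rewrite cat_uniq => /and3P[_ /hasPn/= AB _].
  by apply/negP => /AB; rewrite xA.
move=> ij; rewrite /two_clusters.
case: eqVneq => [i0|i0]; case: eqVneq => [j0|j0] //; last 1 first.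
- case/eqP: ij; apply/val_inj; move: i0 j0; rewrite -!val_eqE /=.
  by case: i j => -[|[|//]] ? [[|[|//]] ?].
- by rewrite i0 j0 eqxx in ij.
- by rewrite fdisjoint_sym.
Qed.

Lemma two_clusters_cover x :
  x \in line (sA ++ sB) <-> exists j, x \in two_clusters j.
Proof.
split=> [/imfsetP[y /= yAB ->]|[j /imfsetP[y /= yj ->]]]; last first.
  by rewrite mem_line mem_cat; case: ifP yj => _ ->; rewrite ?orbT.
move: yAB; rewrite mem_cat => /orP[yA|yB].
  by exists ord0; rewrite /two_clusters mem_line.
by exists ord_max; rewrite /two_clusters mem_line.
Qed.

Definition line_instance : instance R :=
  Instance (isT : (0 < 2)%N) two_clusters_neq0 two_clusters_disjoint
    two_clusters_cover.

Let uA : uniq sA. Proof. by move: uAB; rewrite cat_uniq => /and3P[]. Qed.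
Let uB : uniq sB. Proof. by move: uAB; rewrite cat_uniq => /and3P[]. Qed.

Lemma mem_cluster_image (T : eqType) (F : 'I_2 -> T) y :
  y \in [seq F j | j : 'I_2] = (y == F ord0) || (y == F ord_max).
Proof.
apply/mapP/orP => [[j _ ->]|[/eqP->|/eqP->]]; last 2 first.
- by exists ord0; rewrite ?mem_enum.
- by exists ord_max; rewrite ?mem_enum.
by case: j => -[|[|//]] j2; [left|right]; apply/eqP; congr F; apply/val_inj.
Qed.

Lemma cluster_image_neq0 (T : Type) (F : 'I_2 -> T) : [seq F j | j : 'I_2] <> [::].
Proof. by move/(congr1 size); rewrite size_map size_enum_ord. Qed.

Lemma OPT_line_instance : OPT line_instance = sqdev sA + sqdev sB.
Proof.
have sizeM (s : seq R) : uniq s -> s != [::] ->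
    #|` line s|%:R * sigma (line s) ^+ 2 = sqdev s.
  move=> us s0; rewrite sigma_line_sqr // card_line // mulrC mulfVK //.
  by rewrite pnatr_eq0 size_eq0.
rewrite /OPT /= big_ord_recl big_ord1 /= /two_clusters /=.
by rewrite !sizeM.
Qed.

Lemma sigma_line_gt0 (s : seq R) :
  uniq s -> s != [::] -> 0 < sqdev s -> 0 < sigma (line s).
Proof.
move=> us s0 sq0; rewrite lt0r {2}/sigma sqrtr_ge0 andbT -sqrf_eq0.
by rewrite sigma_line_sqr // gt_eqF // divr_gt0 // ltr0n lt0n size_eq0.
Qed.

Lemma clusters_spread_line :
  0 < sqdev sA -> 0 < sqdev sB -> clusters_spread line_instance.
Proof.
move=> A0 B0 j; rewrite /= /two_clusters.
by case: ifP => _; apply: sigma_line_gt0.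
Qed.

Lemma g_line_le alpha v :
  spread_ratio alpha sA <= v -> spread_ratio alpha sB <= v ->
  g line_instance alpha <= v.
Proof.
move=> Av Bv; apply: seqmax_le => [|a]; first exact/eqP/cluster_image_neq0.
rewrite mem_cluster_image /= /two_clusters /= !spread_ratio_line //.
by case/orP=> /eqP->.
Qed.

Lemma g_line_ge alpha : spread_ratio alpha sA <= g line_instance alpha.
Proof.
apply: le_seqmax; rewrite mem_cluster_image /= /two_clusters /=.
by rewrite !spread_ratio_line ?eqxx.
Qed.

Lemma sigma_max_line_le v : sigma (line sA) <= v -> sigma (line sB) <= v ->
  sigma_max line_instance <= v.
Proof.
move=> Av Bv; apply: seqmax_le => [|a]; first exact/eqP/cluster_image_neq0.
by rewrite mem_cluster_image /= /two_clusters /= => /orP[]/eqP->.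
Qed.

Lemma sigma_max_line_ge : sigma (line sA) <= sigma_max line_instance.
Proof. by apply: le_seqmax; rewrite mem_cluster_image /= /two_clusters /= eqxx. Qed.

Lemma sigma_min_line_ge v : v <= sigma (line sA) -> v <= sigma (line sB) ->
  v <= sigma_min line_instance.
Proof.
move=> Av Bv; apply: le_seqmin => [|a]; first exact/eqP/cluster_image_neq0.
by rewrite mem_cluster_image /= /two_clusters /= => /orP[]/eqP->.
Qed.

Lemma sigma_min_line_le : sigma_min line_instance <= sigma (line sB).
Proof.
by apply: seqmin_le; rewrite mem_cluster_image /= /two_clusters /= eqxx orbT.
Qed.

End TwoClusters.

(** * The hard instance, with [h] the inverse of the number m of grid points *)

Section HardInstance.
Variables (R : realType) (alpha : R) (half : nat) (h L : R).
Hypothesis alpha_gt2 : 2 < alpha.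
Hypothesis half_gt0 : (0 < half)%N.
Hypothesis halfh : half%:R * h = 2^-1.
Hypothesis L_gt0 : 0 < L.
Hypothesis L_alpha : L `^ alpha = h.

Local Notation m := (half + half)%N.

(* Since [m%:R * h = 1], [L_alpha] says [m%:R * L `^ alpha = 1]: the potential
   of the dense cluster, seen from the bulk of the sparse one, is of the same
   order as that of the outlier. *)
Let halfR_ge1 : 1 <= half%:R :> R. Proof. by rewrite ler1n. Qed.
Let mh : m%:R * h = 1. Proof. by rewrite natrD; have := halfh; lra. Qed.
Let m_gt0 : 0 < m%:R :> R. Proof. by rewrite natrD; have := halfR_ge1; lra. Qed.
Let h_gt0 : 0 < h.
Proof. by rewrite -(pmulr_rgt0 _ m_gt0) mh. Qed.
Let h_le1 : h <= 1. Proof. by have := halfR_ge1; have := h_gt0; have := halfh; nra. Qed.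
Let alpha_gt0 : 0 < alpha. Proof. by have := alpha_gt2; lra. Qed.

(** [L] is [h] to the power [alpha^-1], an exponent below 1, and [h <= 1]. *)
Let h_leL : h <= L.
Proof.
rewrite -[leRHS](powRr1 (ltW L_gt0)) -(divff (lt0r_neq0 alpha_gt0)) powRrM L_alpha.
rewrite -[leLHS](powRr1 (ltW h_gt0)) ger_powR ?h_gt0 // invf_le1 //.
by have := alpha_gt2; lra.
Qed.

(** The step [h ^+ 2] fits all m points into an interval of length [h], because m times [h] is 1. *)
Definition grid x : seq R := [seq x + i%:R * h ^+ 2 | i <- iota 0 m].

Lemma size_grid x : size (grid x) = m.
Proof. by rewrite size_map size_iota. Qed.

Lemma grid_uniq x : uniq (grid x).
Proof.
rewrite map_inj_in_uniq ?iota_uniq // => i j _ _ /addrI.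
have h20 : h ^+ 2 != 0 by rewrite expf_neq0 ?gt_eqF.
by move/(mulIf h20)/eqP; rewrite eqr_nat => /eqP.
Qed.

Lemma grid_bounds x y : y \in grid x -> x <= y <= x + h.
Proof.
move=> /mapP[i]; rewrite mem_iota /= => im ->.
have : i%:R * h <= m%:R * h by rewrite ler_wpM2r ?(ltW h_gt0) // ler_nat ltnW.
have : 0 <= i%:R * h by rewrite mulr_ge0 // ltW.
rewrite mh => i0 i1; rewrite expr2 mulrA lerDl lerD2l.
by rewrite mulr_ge0 ?(ltW h_gt0) //= ler_piMl // ltW.
Qed.

Lemma mem_grid x : x \in grid x.
Proof.
apply/mapP; exists 0%N; last by rewrite mul0r addr0.
by rewrite mem_iota /= add0n addn_gt0 half_gt0.
Qed.

(** Each point is paired with the one [half] steps further, at distance [h / 2]; this prepares the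
    use of [sqr_split_ge] on every pair. *)
Lemma sum_grid x (F : R -> R) : \sum_(y <- grid x) F y =
  \sum_(i < half) (F (x + i%:R * h ^+ 2) + F (x + (half + i)%:R * h ^+ 2)).
Proof.
rewrite big_map -[X in iota _ X]subn0 -/(index_iota 0 m) big_mkord.
by rewrite big_split_ord /= -big_split.
Qed.

(** * The two clusters, their deviations and variances *)

Definition sparse : seq R := -1 :: grid 0.
(** The shift leaves a gap [L] after the bulk [grid 0], which lies in [[0, h]]. Since [h <= L],
    distances between bulk and dense points lie between [L] and [3 * L]. *)
Definition dense : seq R := grid (L + h).

Lemma sparse_dense_uniq : uniq (sparse ++ dense).
Proof.
rewrite cat_uniq /= !grid_uniq !andbT; apply/andP; split.
  by apply/negP => /grid_bounds; lra.
have L0 := L_gt0; apply/hasPn => y /grid_bounds yB; rewrite /= inE.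
by apply/negP => /orP[/eqP|/grid_bounds]; lra.
Qed.

Let sparse_uniq : uniq sparse.
Proof. by have := sparse_dense_uniq; rewrite cat_uniq => /andP[]. Qed.

Lemma sparse_neq0 : sparse != [::]. Proof. by []. Qed.

Lemma dense_neq0 : dense != [::].
Proof. by rewrite -size_eq0 size_grid -lt0n addn_gt0 half_gt0. Qed.

Definition hard_instance : instance R :=
  line_instance sparse_dense_uniq sparse_neq0 dense_neq0.

(** The outlier [-1] and the grid point [0], at distance 1, already contribute this much. *)
Lemma sqdev_sparse_ge : 2^-1 <= sqdev sparse.
Proof.
rewrite /sqdev big_cons (perm_big _ (perm_to_rem (mem_grid 0))) big_cons addrA.
apply: ler_wpDr; first by apply: sumr_ge0 => x _; rewrite sqr_ge0.
by apply: le_trans (sqr_split_ge _ _ _); lra.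
Qed.

Lemma sqdev_sparse_le : sqdev sparse <= 2.
Proof.
apply: (le_trans (sqdev_le _ 0)); rewrite big_cons.
have : \sum_(x <- grid 0) (x - 0) ^+ 2 <= (size (grid 0))%:R * h ^+ 2.
  apply: sum_le_const => x /grid_bounds xb.
  by have := h_gt0; rewrite ler_sqr ?nnegrE; lra.
by rewrite size_grid (expr2 h) (mulrA m%:R) mh mul1r; have := h_le1; lra.
Qed.

(** There are [half] pairs at distance [h / 2]; each contributes at least [h ^+ 2 / 8], and
    [half%:R * h] is one half. *)
Lemma sqdev_dense_ge : h / 16 <= sqdev dense.
Proof.
rewrite /sqdev sum_grid; set u := average _.
have -> : h / 16 = \sum_(i < half) h ^+ 2 / 8.
  by rewrite sumr_const card_ord -[RHS]mulr_natl expr2 !mulrA halfh; lra.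
apply: ler_sum => i _; apply: le_trans (sqr_split_ge _ _ _).
have -> : L + h + i%:R * h ^+ 2 - (L + h + (half + i)%:R * h ^+ 2) = - (half%:R * h * h).
  by rewrite natrD; ring.
by rewrite halfh; lra.
Qed.

Lemma sqdev_dense_le : sqdev dense <= h.
Proof.
apply: (le_trans (sqdev_le _ (L + h))).
rewrite [leRHS](_ : h = (size dense)%:R * h ^+ 2); last first.
  by rewrite size_grid expr2 mulrA mh mul1r.
apply: sum_le_const => x /grid_bounds xb.
by have := h_gt0; rewrite ler_sqr ?nnegrE; lra.
Qed.

Lemma hard_instance_spread : clusters_spread hard_instance.
Proof.
apply: clusters_spread_line; first by have := sqdev_sparse_ge; lra.
by have := sqdev_dense_ge; have := h_gt0; lra.
Qed.

Lemma OPT_hard_instance_le : OPT hard_instance <= 3.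
Proof.
rewrite OPT_line_instance.
by have := sqdev_sparse_le; have := sqdev_dense_le; have := h_le1; lra.
Qed.

Let size_sparse : (size sparse)%:R = m%:R + 1 :> R.
Proof. by rewrite /= size_grid natr1. Qed.

Lemma var_sparse_ge : h / 4 <= sqdev sparse / (size sparse)%:R.
Proof.
rewrite size_sparse ler_pdivlMr; last by have := m_gt0; lra.
by have := sqdev_sparse_ge; have := mh; have := h_le1; lra.
Qed.

Lemma var_sparse_le : sqdev sparse / (size sparse)%:R <= 2 * h.
Proof.
rewrite size_sparse ler_pdivrMr; last by have := m_gt0; lra.
by have := sqdev_sparse_le; have := mh; have := h_gt0; lra.
Qed.

Lemma var_dense_ge : (h / 4) ^+ 2 <= sqdev dense / (size dense)%:R.
Proof.
rewrite size_grid ler_pdivlMr //.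
have -> : (h / 4) ^+ 2 * m%:R = m%:R * h * h / 16 by field.
by rewrite mh mul1r sqdev_dense_ge.
Qed.

Lemma var_dense_le : sqdev dense / (size dense)%:R <= h ^+ 2.
Proof.
rewrite size_grid ler_pdivrMr // mulrC expr2 mulrA mh mul1r.
exact: sqdev_dense_le.
Qed.

(** * Spread ratios of the two clusters *)

Let size_sqr_sparse_gt0 : 0 < (size sparse)%:R ^+ 2 :> R.
Proof. by rewrite size_sparse exprn_gt0 //; have := m_gt0; lra. Qed.

(** Pairwise distances are at most [h], while the standard deviation is at least [h / 4]. *)
Lemma spread_ratio_dense_le : spread_ratio alpha dense <= 4 `^ alpha.
Proof.
have h40 : 0 < h / 4 by rewrite divr_gt0.
have den : (h / 4) `^ alpha <= (sqdev dense / (size dense)%:R) `^ (alpha / 2).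
  have -> : alpha = 2 * (alpha / 2) by field.
  rewrite {1}powRrM powR_mulrn ?(ltW h40) // [2 * _]mulrC mulfK //.
  by rewrite ge0_ler_powR ?nnegrE ?sqr_ge0 ?divr_ge0 ?sqdev_ge0 ?var_dense_ge // ltW.
have num : (size dense)%:R ^- 2 *
    (\sum_(z <- dense) \sum_(x <- dense) `|x - z| `^ alpha) <= h `^ alpha.
  rewrite mulrC ler_pdivrMr ?exprn_gt0 ?size_grid // mulrC expr2 -mulrA.
  rewrite -(size_grid (L + h)); apply: sum_le_const => z /grid_bounds zb.
  apply: sum_le_const => x /grid_bounds xb; rewrite ge0_ler_powR ?nnegrE //.
  - exact: ltW.
  - exact: ltW.
  by rewrite ler_norml; lra.
rewrite /spread_ratio ler_pdivrMr; last by apply: lt_le_trans den; apply: powR_gt0.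
apply: (le_trans num); apply: le_trans (ler_wpM2l (powR_ge0 _ _) den).
rewrite -powRM //; last exact: ltW.
by rewrite mulrC divfK.
Qed.

Lemma powR4_half : 4 `^ (alpha / 2) = 2 `^ alpha :> R.
Proof.
rewrite (_ : 4 = 2 `^ 2); last by rewrite powR_mulrn // -natrX.
by rewrite -powRrM mulrC divfK.
Qed.

(** This bounds the total potential of a grid seen from one of its own points. *)
Let h_alpha_le : m%:R * h `^ alpha <= 1.
Proof.
rewrite -[leRHS]mh ler_pM2l // -[leRHS]powRr1 ?(ltW h_gt0) //.
by rewrite ger_powR ?h_gt0 //; have := alpha_gt2; lra.
Qed.

Let pow2_ge1 : 1 <= 2 `^ alpha :> R.
Proof. by rewrite -[leLHS](powRr0 2) ler_powR ?ler1n // ltW. Qed.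

Lemma spread_ratio_sparse_le :
  spread_ratio alpha sparse <= 3 * 4 `^ alpha * (h / h `^ (alpha / 2)).
Proof.
have h40 : 0 < h / 4 by rewrite divr_gt0.
have hE : (h / 4) `^ (alpha / 2) = h `^ (alpha / 2) / 2 `^ alpha.
  rewrite powRM ?(ltW h_gt0) // -(powR_inv1 (ler0n R 4)) -powRrM mulN1r powRN.
  by rewrite powR4_half.
have den : (h / 4) `^ (alpha / 2) <=
    (sqdev sparse / (size sparse)%:R) `^ (alpha / 2).
  rewrite ge0_ler_powR ?nnegrE ?var_sparse_ge ?divr_ge0 ?sqdev_ge0 ?(ltW alpha_gt0) //.
  exact: ltW.
have num : \sum_(z <- sparse) \sum_(x <- sparse) `|x - z| `^ alpha <=
    m%:R * (3 * 2 `^ alpha).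
  have edge u : `|u| <= 2 -> `|u| `^ alpha <= 2 `^ alpha.
    by move=> u2; rewrite ge0_ler_powR ?nnegrE ?(ltW alpha_gt0).
  have h0 := h_gt0; have h1 := h_le1.
  have from_far : \sum_(x <- sparse) `|x - -1| `^ alpha <= m%:R * 2 `^ alpha.
    rewrite big_cons subrr normr0 powR0 ?gt_eqF // add0r -(size_grid 0).
    apply: sum_le_const => x /grid_bounds xb; apply: edge.
    by rewrite ler_norml; lra.
  have from_near : \sum_(z <- grid 0) \sum_(x <- sparse) `|x - z| `^ alpha <=
      m%:R * (2 * 2 `^ alpha).
    rewrite -(size_grid 0); apply: sum_le_const => z /grid_bounds zb.
    rewrite big_cons mulr_natl mulr2n lerD //.
      by apply: edge; rewrite ler_norml; lra.
    apply: (le_trans _ pow2_ge1); apply: (le_trans _ h_alpha_le).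
    rewrite -(size_grid 0); apply: sum_le_const => x /grid_bounds xb.
    rewrite ge0_ler_powR ?nnegrE ?(ltW alpha_gt0) ?(ltW h_gt0) //.
    by rewrite ler_norml; lra.
  rewrite big_cons; apply: (le_trans (lerD from_far from_near)).
  by rewrite -mulrDr; lra.
rewrite /spread_ratio ler_pdivrMr; last by apply: lt_le_trans den; apply: powR_gt0.
apply: le_trans (ler_wpM2l _ den); last first.
  by rewrite !mulr_ge0 ?invr_ge0 ?powR_ge0 // ltW.
have -> : 3 * 4 `^ alpha * (h / h `^ (alpha / 2)) * (h / 4) `^ (alpha / 2) =
    3 * 2 `^ alpha * h.
  have -> : 4 `^ alpha = 2 `^ alpha * 2 `^ alpha :> R.
    by rewrite -powRM // -natrM.
  rewrite hE; field.
  by rewrite !gt_eqF ?powR_gt0.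
rewrite mulrC ler_pdivrMr //; apply: (le_trans num).
rewrite [leLHS]mulrC -[leRHS]mulrA ler_wpM2l ?mulr_ge0 ?powR_ge0 // size_sparse.
have -> : h * (m%:R + 1) ^+ 2 = m%:R * h * m%:R + 2 * (m%:R * h) + h by ring.
by rewrite mh; have := h_gt0; lra.
Qed.

(** Each of the m bulk points is at distance at least 1 from the outlier, and the variance is at
    most [2 * h]. *)
Lemma spread_ratio_sparse_ge :
  h / 4 / (2 * h) `^ (alpha / 2) <= spread_ratio alpha sparse.
Proof.
have den : (sqdev sparse / (size sparse)%:R) `^ (alpha / 2) <= (2 * h) `^ (alpha / 2).
  rewrite ge0_ler_powR ?nnegrE ?var_sparse_le ?divr_ge0 ?sqdev_ge0 //.
  - exact: ltW.
  - by rewrite mulr_ge0 // ltW.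
have den0 : 0 < (sqdev sparse / (size sparse)%:R) `^ (alpha / 2).
  by apply/powR_gt0/(lt_le_trans _ var_sparse_ge); rewrite divr_gt0.
rewrite /spread_ratio ler_pM ?divr_ge0 ?invr_ge0 ?powR_ge0 ?(ltW h_gt0) //; last first.
  by rewrite lef_pV2 ?posrE // powR_gt0 // mulr_gt0.
rewrite [leRHS]mulrC ler_pdivlMr //.
have num : m%:R <= \sum_(z <- sparse) \sum_(x <- sparse) `|x - z| `^ alpha.
  rewrite big_cons; apply: ler_wpDl.
    by apply: sumr_ge0 => x _; apply: powR_ge0.
  rewrite -[leLHS]mulr1 -(size_grid 0); apply: const_le_sum => z /grid_bounds zb.
  rewrite big_cons; apply: ler_wpDr.
    by apply: sumr_ge0 => x _; apply: powR_ge0.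
  rewrite -[leLHS](powRr0 `|-1 - z|) ler_powR ?(ltW alpha_gt0) //.
  by rewrite ler0_norm; lra.
apply: le_trans num; rewrite size_sparse.
have m2 : 2 <= m%:R :> R by rewrite natrD; have := halfR_ge1; lra.
have -> : h / 4 * (m%:R + 1) ^+ 2 = (m%:R * h * m%:R + 2 * (m%:R * h) + h) / 4 by field.
by rewrite mh; have := h_le1; lra.
Qed.

(** * Expected cost of seeding on the hard instance *)

Lemma seeding_hard_ge :
  L ^+ 2 / h / (9 * 3 `^ alpha) <= seeding_cost hard_instance alpha.
Proof.
pose X := line (sparse ++ dense).
have uX := sparse_dense_uniq.
(* [K] bounds the sum of all weights seen from a bulk point: at most [3]^
   alpha[from the outlier, 1 from the bulk and]3 [^ alpha] from the dense cluster. *)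
pose K : R := 3 * 3 `^ alpha.
have pow3_ge1 : 1 <= 3 `^ alpha :> R.
  by rewrite -[leLHS](powRr0 3) ler_powR ?ler1n // ltW.
have K0 : 0 < K by rewrite /K; lra.
have uS := grid_uniq 0.
have cardX : #|` X|%:R <= 3 * m%:R :> R.
  rewrite card_line // size_cat natrD size_sparse size_grid.
  have : 1 <= m%:R :> R by rewrite ler1n addn_gt0 half_gt0.
  by lra.
(* The factors are those of [expected_cost2_ge] with [S] the bulk and [p] the outlier: number of
   bulk points, lower bound on the inverse of the number of points, second-draw probability, and
   cost of the uncovered dense cluster. *)
have -> : L ^+ 2 / h / (9 * 3 `^ alpha) =
    #|` line (grid 0)|%:R * ((3 * m%:R)^-1 * (K^-1 * (m%:R * L ^+ 2))).
  rewrite card_line // size_grid.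
  have -> : h^-1 = m%:R.
    by apply: (mulIf (lt0r_neq0 h_gt0)); rewrite mulVf ?mh // gt_eqF.
  rewrite /K; move: m_gt0 pow3_ge1; move: m%:R (3 `^ alpha) => x y x0 y1.
  by field; rewrite !gt_eqF //; lra.
have step a : a \in line (grid 0) -> K^-1 * (m%:R * L ^+ 2) <=
    next_prob alpha X [fset a] (const_mx (-1)) * cost 2 X [fset a; const_mx (-1)].
  move=> /imfsetP[{}a /= /grid_bounds ab ->].
  have hL := h_leL; have h0 := h_gt0; have h1 := h_le1; have L0 := L_gt0.
  have edge u v : `|u| <= v -> `|u| `^ alpha <= v `^ alpha.
    move=> uv; rewrite ge0_ler_powR ?nnegrE ?(ltW alpha_gt0) //.
    exact: le_trans uv.
  (* Probability and cost are bounded separately: the outlier has weight at least 1 out of at most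
     [K], and each dense point is at distance at least [L] from both centers. *)
  rewrite ler_pM ?invr_ge0 ?mulr_ge0 ?(ltW L0) ?(ltW K0) //.
    have far : 1 <= `|-1 - a| `^ alpha.
      rewrite -[leLHS](powRr0 `|-1 - a|) ler_powR ?(ltW alpha_gt0) //.
      by rewrite ler0_norm; lra.
    rewrite /next_prob mindist1 enorm_const -/(cost alpha X _) cost1 sum_line //.
    under eq_bigr do rewrite enorm_const.
    rewrite big_cat big_cons /=.
    set D := (X in _ <= _ / X).
    have D_ge1 : 1 <= D.
      rewrite /D -addrA; apply: (le_trans far); rewrite lerDl.
      by rewrite addr_ge0 //; apply: sumr_ge0 => x _; apply: powR_ge0.
    have D_leK : D <= K.
      have D1 : `|-1 - a| `^ alpha <= 3 `^ alpha.
        by apply: edge; rewrite ler_norml; lra.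
      have D2 : \sum_(x <- grid 0) `|x - a| `^ alpha <= 1.
        apply: (le_trans _ h_alpha_le); rewrite -(size_grid 0).
        apply: sum_le_const => x /grid_bounds xb; apply: edge.
        by rewrite ler_norml; lra.
      have D3 : \sum_(x <- dense) `|x - a| `^ alpha <= 3 `^ alpha.
        have -> : 3 `^ alpha = m%:R * (3 * L) `^ alpha :> R.
          by rewrite powRM ?(ltW L0) // L_alpha mulrCA mh mulr1.
        rewrite -{1}(size_grid (L + h)).
        apply: sum_le_const => x /grid_bounds xb; apply: edge.
        by rewrite ler_norml; lra.
      by rewrite /D /K; lra.
    rewrite ler_pdivlMr ?(lt_le_trans _ D_ge1) // mulrC.
    by apply: le_trans far; rewrite ler_pdivrMr // mul1r.
  rewrite /cost sum_line // big_cat /=; apply: ler_wpDl.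
    by apply: sumr_ge0 => x _; apply: mindist_ge0.
  rewrite -(size_grid (L + h)); apply: const_le_sum => x /grid_bounds xb.
  by apply: le_mindist2; rewrite enorm_const powR_mulrn // real_normK ?num_real //;
    rewrite ler_sqr ?nnegrE; lra.
apply: (le_trans _ (expected_cost2_ge _ _ step)).
- rewrite ler_wpM2l // ler_wpM2r //.
    by rewrite !mulr_ge0 ?invr_ge0 ?sqr_ge0 // ltW.
  rewrite lef_pV2 ?posrE //; first by rewrite mulr_gt0.
  by rewrite card_line // ltr0n size_cat.
- apply/fsubsetP => _ /imfsetP[x /= xg ->].
  by rewrite mem_line mem_cat inE xg orbT.
- by rewrite mem_line mem_cat mem_head.
Qed.

(** * Comparison of [g] with the seeding cost *)

Let h_pow : h `^ (2 / alpha) = L ^+ 2.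
Proof.
rewrite -L_alpha -powRrM mulrCA mulfV ?gt_eqF // mulr1.
by rewrite powR_mulrn // ltW.
Qed.

Lemma g_hard_ge : (half%:R `^ (alpha / 2 - 1)) / 8 <= g hard_instance alpha.
Proof.
apply: le_trans (g_line_ge _ _ _ _); apply: le_trans spread_ratio_sparse_ge.
have -> : 2 * h = half%:R^-1.
  have half0 : half%:R != 0 :> R by rewrite gt_eqF // ltr0n.
  by apply: (mulfI half0); rewrite mulrCA halfh !mulfV.
rewrite -(powR_inv1 (ler0n R half)) -powRrM mulN1r powRN invrK.
rewrite -(@mulr_powRB1 _ half%:R (alpha / 2)) ?ler0n ?divr_gt0 //.
set P := half%:R `^ _; have -> : h / 4 * (half%:R * P) = half%:R * h * P / 4 by ring.
by rewrite halfh; lra.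
Qed.

(** The sparse cluster gives this bound; it also covers the dense one, since [h <= 1] and
    [alpha / 2] exceeds 1. *)
Lemma g_hard_le : g hard_instance alpha <= 3 * 4 `^ alpha * (h / h `^ (alpha / 2)).
Proof.
apply: g_line_le; first exact: spread_ratio_sparse_le.
apply: (le_trans spread_ratio_dense_le).
have : 1 <= h / h `^ (alpha / 2).
  rewrite ler_pdivlMr ?powR_gt0 // mul1r -[leRHS]powRr1 ?(ltW h_gt0) //.
  by rewrite ger_powR ?h_gt0 //; have := alpha_gt2; lra.
by have := powR_ge0 (4 : R) alpha; nra.
Qed.

Lemma g_hard_pow_le :
  g hard_instance alpha `^ (2 / alpha) <=
  (3 * 4 `^ alpha) `^ (2 / alpha) * (L ^+ 2 / h).
Proof.
have g0 : 0 <= g hard_instance alpha.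
  by apply: le_trans g_hard_ge; rewrite divr_ge0 ?powR_ge0.
have alpha2_ge0 : 0 <= 2 / alpha by rewrite divr_ge0 // ltW.
apply: (@le_trans _ _
    ((3 * 4 `^ alpha * (h / h `^ (alpha / 2))) `^ (2 / alpha))).
  rewrite ge0_ler_powR ?nnegrE // ?g_hard_le //.
  exact: le_trans g_hard_le.
rewrite powRM ?divr_ge0 ?mulr_ge0 ?powR_ge0 ?(ltW h_gt0) //.
rewrite -powRN [X in _ * X <= _]powRM ?powR_ge0 ?(ltW h_gt0) // h_pow.
rewrite -(powRrM h).
have -> : - (alpha / 2) * (2 / alpha) = -1 by field; rewrite gt_eqF.
by rewrite powR_inv1 // ltW.
Qed.

(** * Comparison of [sigma_max / sigma_min] with the seeding cost *)

Let sigma_sparse_ge : h / 4 <= sigma (line sparse) ^+ 2.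
Proof. by rewrite sigma_line_sqr ?var_sparse_ge ?sparse_uniq. Qed.

Let sigma_sparse_le : sigma (line sparse) ^+ 2 <= 2 * h.
Proof. by rewrite sigma_line_sqr ?var_sparse_le ?sparse_uniq. Qed.

Let sigma_dense_ge : (h / 4) ^+ 2 <= sigma (line dense) ^+ 2.
Proof. by rewrite sigma_line_sqr ?var_dense_ge ?grid_uniq. Qed.

Let sigma_dense_le : sigma (line dense) ^+ 2 <= h ^+ 2.
Proof. by rewrite sigma_line_sqr ?var_dense_le ?grid_uniq. Qed.

Let sigma_ge0 (C : {fset 'rV[R]_1}) : 0 <= sigma C.
Proof. exact: sqrtr_ge0. Qed.

Lemma sigma_min_hard_ge : h / 4 <= sigma_min hard_instance.
Proof.
have h40 : 0 <= h / 4 by rewrite divr_ge0 // ltW.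
apply: sigma_min_line_ge; rewrite -(@ler_pXn2r _ 2) ?nnegrE ?sigma_ge0 //.
  apply: le_trans sigma_sparse_ge.
  by rewrite expr2; have := h_gt0; have := h_le1; nra.
Qed.

Lemma sigma_max_hard_le : sigma_max hard_instance <= Num.sqrt (2 * h).
Proof.
have h20 : 0 <= 2 * h by rewrite mulr_ge0 // ltW.
apply: sigma_max_line_le; rewrite -(@ler_pXn2r _ 2) ?nnegrE ?sigma_ge0 ?sqrtr_ge0 //;
  rewrite [leRHS]sqr_sqrtr //.
apply: (le_trans sigma_dense_le).
by rewrite expr2; have := h_gt0; have := h_le1; nra.
Qed.

Let sigma_max_ge0 : 0 <= sigma_max hard_instance.
Proof. by apply: le_trans (sigma_max_line_ge _ _ _). Qed.

Let sigma_min_gt0 : 0 < sigma_min hard_instance.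
Proof. by apply: lt_le_trans sigma_min_hard_ge; rewrite divr_gt0. Qed.

(** The squared ratio is at least [h / 4] over [h ^+ 2], from the sparse and the dense cluster
    respectively. This makes the ratio unbounded along the family. *)
Lemma sigma_hard_ratio_ge :
  Num.sqrt (half%:R / 2) <= sigma_max hard_instance / sigma_min hard_instance.
Proof.
rewrite -(@ler_pXn2r _ 2) ?nnegrE ?sqrtr_ge0 ?divr_ge0 ?(ltW sigma_min_gt0) //.
rewrite sqr_sqrtr ?divr_ge0 // expr_div_n ler_pdivlMr ?exprn_gt0 //.
apply: (@le_trans _ _ (h / 4)); last first.
  apply: (le_trans sigma_sparse_ge).
  by rewrite ler_pXn2r ?nnegrE ?sigma_ge0 // sigma_max_line_ge.
have -> : h / 4 = half%:R / 2 * h ^+ 2.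
  have -> : half%:R / 2 * h ^+ 2 = half%:R * h * h / 2 by ring.
  by rewrite halfh; field.
rewrite ler_wpM2l ?divr_ge0 //; apply: le_trans sigma_dense_le.
by rewrite ler_pXn2r ?nnegrE ?(ltW sigma_min_gt0) ?sigma_ge0 // sigma_min_line_le.
Qed.

Lemma sigma_hard_ratio_pow_le :
  (sigma_max hard_instance / sigma_min hard_instance) `^ (2 - 4 / alpha) <=
  32 * (L ^+ 2 / h).
Proof.
set r := sigma_max _ / _; have r0 : 0 <= r by rewrite divr_ge0 // ltW.
have e_ge0 : 0 <= 1 - 2 / alpha.
  by rewrite subr_ge0 ler_pdivrMr // mul1r ltW.
have e_le1 : 1 - 2 / alpha <= 1 by rewrite gerBl divr_ge0 // ltW.
(* 32 is the quotient of [2 * h] by [(h / 4) ^+ 2], up to the factor [h^-1]. *)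
have r2 : r ^+ 2 <= 32 * h^-1.
  rewrite expr_div_n ler_pdivrMr ?exprn_gt0 //.
  apply: (@le_trans _ _ (2 * h)).
    rewrite -[leRHS]sqr_sqrtr ?mulr_ge0 ?(ltW h_gt0) //.
    by rewrite ler_pXn2r ?nnegrE ?sqrtr_ge0 // sigma_max_hard_le.
  have -> : 2 * h = 32 * h^-1 * (h / 4) ^+ 2 by field; rewrite gt_eqF.
  rewrite ler_wpM2l ?mulr_ge0 ?invr_ge0 ?(ltW h_gt0) //.
  rewrite ler_pXn2r ?nnegrE ?(ltW sigma_min_gt0) ?divr_ge0 ?(ltW h_gt0) //.
  exact: sigma_min_hard_ge.
have -> : 2 - 4 / alpha = 2 * (1 - 2 / alpha) by ring.
rewrite powRrM powR_mulrn //.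
apply: (@le_trans _ _ ((32 * h^-1) `^ (1 - 2 / alpha))).
  by rewrite ge0_ler_powR ?nnegrE ?sqr_ge0 ?mulr_ge0 ?invr_ge0 ?(ltW h_gt0).
rewrite powRM ?invr_ge0 ?(ltW h_gt0) // ler_pM ?powR_ge0 //.
  by rewrite ler1_powR // ler1n.
rewrite -powR_inv1 ?(ltW h_gt0) // -powRrM.
have -> : -1 * (1 - 2 / alpha) = 2 / alpha - 1 by ring.
by rewrite powRB ?(gt_eqF h_gt0) ?implybT // h_pow powRr1 ?powR_inv1 ?(ltW h_gt0).
Qed.

(** [w] stands for the power of [g] or of the sigma ratio. The constant absorbs both [c] and the
    bound 3 on [OPT]. *)
Lemma hard_instance_bound c w :
  0 < c -> 0 <= w -> w <= c * (L ^+ 2 / h) ->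
  (9 * 3 `^ alpha)^-1 / (3 * c) * w * OPT hard_instance <=
  seeding_cost hard_instance alpha.
Proof.
move=> c0 w0 wc; apply: le_trans seeding_hard_ge.
have K0 : 0 < 9 * 3 `^ alpha :> R by rewrite mulr_gt0 ?powR_gt0.
rewrite [leRHS]mulrC -!mulrA ler_pM2l ?invr_gt0 // ler_pdivrMl ?mulr_gt0 //.
rewrite [leRHS](_ : _ = c * (L ^+ 2 / h) * 3); last by ring.
have OPT0 : 0 <= OPT hard_instance.
  by rewrite OPT_line_instance addr_ge0 ?sqdev_ge0.
by rewrite ler_pM // OPT_hard_instance_le.
Qed.

End HardInstance.

(** * The family of instances and the two lower bounds *)

Lemma hard_instance_exists (R : realType) (alpha : R) (n : nat) : 2 < alpha ->
  exists I : instance R,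
    [/\ clusters_spread I,
        n.+1%:R `^ (alpha / 2 - 1) / 8 <= g I alpha,
        Num.sqrt (n.+1%:R / 2) <= sigma_max I / sigma_min I,
        (9 * 3 `^ alpha)^-1 / (3 * (3 * 4 `^ alpha) `^ (2 / alpha)) *
          g I alpha `^ (2 / alpha) * OPT I <= seeding_cost I alpha &
        (9 * 3 `^ alpha)^-1 / (3 * 32) *
          (sigma_max I / sigma_min I) `^ (2 - 4 / alpha) * OPT I <=
        seeding_cost I alpha].
Proof.
move=> alpha_gt2; pose h : R := (2 * n.+1%:R)^-1; pose L := h `^ alpha^-1.
have h_gt0 : 0 < h by rewrite invr_gt0 mulr_gt0.
have halfh : n.+1%:R * h = 2^-1.
  by rewrite /h invfM mulrCA mulfV ?mulr1 // pnatr_eq0.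
have L_gt0 : 0 < L by apply: powR_gt0.
have L_alpha : L `^ alpha = h.
  by rewrite -powRrM mulVf ?powRr1 ?(ltW h_gt0) // gt_eqF //; lra.
exists (hard_instance (ltn0Sn n) halfh L_gt0); split.
- exact: hard_instance_spread.
- exact: g_hard_ge.
- exact: sigma_hard_ratio_ge.
- apply: hard_instance_bound => //; last exact: g_hard_pow_le.
  exact: powR_ge0.
- apply: hard_instance_bound => //; last exact: sigma_hard_ratio_pow_le.
  exact: powR_ge0.
Qed.

Theorem theorem2 (R : realType) (alpha : R) (alpha_gt2 : 2 < alpha) :
  (exists (c : R) (F : nat -> instance R),
     [/\ 0 < c,
         forall n, clusters_spread (F n),
         forall M : R, exists n, M < g (F n) alpha &
         forall n, c * g (F n) alpha `^ (2 / alpha) * OPT (F n)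
                     <= seeding_cost (F n) alpha])
  /\
  (exists (c : R) (F : nat -> instance R),
     [/\ 0 < c,
         forall n, clusters_spread (F n),
         forall M : R, exists n, M < sigma_max (F n) / sigma_min (F n) &
         forall n, c * (sigma_max (F n) / sigma_min (F n)) `^ (2 - 4 / alpha)
                     * OPT (F n)
                     <= seeding_cost (F n) alpha]).
Proof.
have [F FP] := choice (fun n => hard_instance_exists n alpha_gt2).
have K0 : 0 < 9 * 3 `^ alpha :> R by rewrite mulr_gt0 ?powR_gt0.
split.
  exists ((9 * 3 `^ alpha)^-1 / (3 * (3 * 4 `^ alpha) `^ (2 / alpha))), F.
  split=> [|n|M|n]; try by case: (FP n).
    by rewrite divr_gt0 ?invr_gt0 // mulr_gt0 // powR_gt0 // mulr_gt0 ?powR_gt0.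
  pose e := alpha / 2 - 1; have e0 : 0 < e by rewrite /e; lra.
  (* [y] solves [y]^ e = 8 * [|M|], so any [half] above [y] makes the lower bound on [g] exceed
     [M]. *)
  pose y := (8 * `|M|) `^ e^-1.
  exists (Num.bound y); case: (FP (Num.bound y)) => _ gn _ _ _.
  apply: lt_le_trans gn; rewrite -/e ltr_pdivlMr //.
  apply: (@le_lt_trans _ _ (y `^ e)).
    rewrite /y -powRrM mulVf ?gt_eqF // powRr1 ?mulr_ge0 //.
    by have := ler_norm M; lra.
  rewrite gt0_ltr_powR ?nnegrE ?powR_ge0 //.
  apply: (lt_le_trans (archi_boundP (powR_ge0 _ _))).
  by rewrite ler_nat.
exists ((9 * 3 `^ alpha)^-1 / (3 * 32)), F.
split=> [|n|M|n]; try by case: (FP n).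
  by rewrite divr_gt0 ?invr_gt0.
(* For [half] above [y], the root of [half%:R / 2] exceeds the absolute value of [M]. *)
pose y := 2 * M ^+ 2; have y0 : 0 <= y by rewrite mulr_ge0 ?sqr_ge0.
exists (Num.bound y); case: (FP (Num.bound y)) => _ _ rn _ _.
apply: lt_le_trans rn; apply: (le_lt_trans (ler_norm M)).
rewrite -(@ltr_pXn2r _ 2) ?nnegrE ?sqrtr_ge0 // real_normK ?num_real //.
rewrite sqr_sqrtr ?divr_ge0 //.
have : y < (Num.bound y).+1%:R.
  apply: (lt_le_trans (archi_boundP y0)).
  by rewrite ler_nat.
by rewrite /y; lra.
Qed.
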